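(* Let $d\ge c>0$ and $\mu>0$. The set $\mathcal M=\mathcal M_1\cup\mathcal M_2\cup\mathcal M_3\cup\mathcal M_4\cup\mathcal M_5\cup\mathcal M_6$ defined in the context is forward invariant for the hybrid system $\mathcal H_\varepsilon$ defined in the context.
   Context: Constants $d\ge c>0$, $\mu>0$. Let $\mathcal P=\{0,1,2,3,4,5\}$, $\mathcal Q=\{0,1\}$. The state is $x=(\tau_i,\tau_k,a_i,a_k,\tau,m^i,m^k,p,q)\in\mathcal X:=\mathbb R\times\mathbb R\times\mathbb R\times\mathbb R\times[0,d]\times\mathbb R^6\times\mathbb R^6\times\mathcal P\times\mathcal Q$, with $m^i=(m^i_1,\dots,m^i_6)$, $m^k=(m^k_1,\dots,m^k_6)$. Set $F(x)=(a_i,a_k,0,0,-1,0,0,0,0)$, and $K_{\tilde o}(m^i)=\tfrac12(m^i_4-m^i_5-m^i_2+m^i_3)$, $K_a(m^i,\tau_k)=\mu\big((m^i_1-m^i_5)-(\tau_k-m^i_4)\big)$. Jump maps, with components listed in the order of $x$: $G_1(x)=(\tau_i,\tau_k,a_i,a_k,d,(\tau_i,m^i_1,\dots,m^i_5),m^k,p+1,1)$, $G_2(x)=(\tau_i,\tau_k,a_i,a_k,c,m^i,(\tau_k,m^i_1,\dots,m^i_5),p+1,0)$, $G_3(x)=(\tau_i,\tau_k,a_i,a_k,d,m^i,(\tau_k,m^k_1,\dots,m^k_5),p+1,1)$, $G_4(x)=(\tau_i,\tau_k,a_i,a_k,c,(\tau_i,m^k_1,\dots,m^k_5),m^k,p+1,0)$,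 $G_5(x)=(\tau_i,\tau_k,a_i,a_k,d,(\tau_i,m^i_1,\dots,m^i_5),m^k,p+1,1)$, $G_6(x)=(\tau_i,\tau_k-K_{\tilde o}(m^i),a_i,a_k+K_a(m^i,\tau_k),c,m^i,(\tau_k,m^i_1,\dots,m^i_5),0,0)$. Error system: $\varepsilon=(\varepsilon_\tau,\varepsilon_a)\in\mathbb R^2$ represents $\varepsilon_\tau=\tau_i-\tau_k$, $\varepsilon_a=a_i-a_k$, and $x_\varepsilon=(\varepsilon,x)\in\mathcal X_\varepsilon:=\mathbb R^2\times\mathcal X$. The data of $\mathcal H_\varepsilon=(C_\varepsilon,F_\varepsilon,D_\varepsilon,G_\varepsilon)$ ($\dot x_\varepsilon=F_\varepsilon(x_\varepsilon)$ for $x_\varepsilon\in C_\varepsilon$; $x_\varepsilon^+=G_\varepsilon(x_\varepsilon)$ for $x_\varepsilon\in D_\varepsilon$) are: $F_\varepsilon(x_\varepsilon)=(A_f\varepsilon,F(x))$ with $A_f=\begin{bmatrix}0&1\\0&0\end{bmatrix}$; $C_\varepsilon=C_{\varepsilon_1}\cup C_{\varepsilon_2}$, $C_{\varepsilon_1}=\{x_\varepsilon\in\mathcal X_\varepsilon:q=0,\tau\in[0,c]\}$, $C_{\varepsilon_2}=\{x_\varepsilon\in\mathcal X_\varepsilon:q=1,\tau\in[0,d]\}$; $D_\varepsilon=\bigcup_{\ell=1}^6D_{\varepsilon_\ell}$, $D_{\varepsilon_\ell}=\{x_\varepsilon\in\mathcal X_\varepsilon:\tau=0,\ p=\ell-1\}$;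 $G_\varepsilon(x_\varepsilon)=G_{\varepsilon_\ell}(x_\varepsilon)$ if $x_\varepsilon\in D_{\varepsilon_\ell}$, where $G_{\varepsilon_\ell}(x_\varepsilon)=(\varepsilon,G_\ell(x))$ for $\ell\in\{1,\dots,5\}$ and $G_{\varepsilon_6}(x_\varepsilon)=\big(\varepsilon+(K_{\tilde o}(m^i),-K_a(m^i,\tau_k)),\,G_6(x)\big)$. The set $\mathcal M$: for $\beta\ge0$ let $\rho_i(x_\varepsilon,\beta)=\tau_i-a_i((1-q)c+qd-\tau)-a_i\beta$, $\rho_k(x_\varepsilon,\beta)=\tau_k-a_k((1-q)c+qd-\tau)-a_k\beta$. Then (all subsets of $\mathcal X_\varepsilon$) $\mathcal M_1=\{p=0,q=0\}$; $\mathcal M_2=\{p=1,q=1,\ m^i_1=\rho_i(x_\varepsilon,0)\}$; $\mathcal M_3=\{p=2,q=0,\ m^k_1=\rho_k(x_\varepsilon,0),\ m^k_2=\rho_i(x_\varepsilon,d)\}$; $\mathcal M_4=\{p=3,q=1,\ m^k_1=\rho_k(x_\varepsilon,0),\ m^k_2=\rho_k(x_\varepsilon,c),\ m^k_3=\rho_i(x_\varepsilon,c+d)\}$; $\mathcal M_5=\{p=4,q=0,\ m^i_1=\rho_i(x_\varepsilon,0),\ m^i_2=\rho_k(x_\varepsilon,d),\ m^i_3=\rho_k(x_\varepsilon,c+d),\ m^i_4=\rho_i(x_\varepsilon,2d+c)\}$; $\mathcal M_6=\{p=5,q=1,\ m^i_1=\rho_i(x_\varepsilon,0),\ m^i_2=\rho_i(x_\varepsilon,c),\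 m^i_3=\rho_k(x_\varepsilon,c+d),\ m^i_4=\rho_k(x_\varepsilon,2c+d),\ m^i_5=\rho_i(x_\varepsilon,2c+2d)\}$. Solutions (in the sense of Goebel–Sanfelice–Teel): a hybrid time domain is a set $E\subset\mathbb R_{\ge0}\times\mathbb N$ such that for each $(T,J)\in E$, $E\cap([0,T]\times\{0,\dots,J\})=\bigcup_{j=0}^J([t_j,t_{j+1}]\times\{j\})$ for some $0=t_0\le t_1\le\dots\le t_{J+1}$. A solution $\phi$ is a function on a hybrid time domain $\mathrm{dom}\,\phi$, locally absolutely continuous in $t$ on each interval $I^j=\{t:(t,j)\in\mathrm{dom}\,\phi\}$, with $\phi(0,0)\in C_\varepsilon\cup D_\varepsilon$; $\phi(t,j)\in C_\varepsilon$ for all $t$ in the interior of $I^j$ and $\frac{d}{dt}\phi(t,j)=F_\varepsilon(\phi(t,j))$ for almost all $t\in I^j$; and $\phi(t,j)\in D_\varepsilon$, $\phi(t,j+1)=G_\varepsilon(\phi(t,j))$ whenever $(t,j),(t,j+1)\in\mathrm{dom}\,\phi$. It is maximal if it cannot be extended by flow or a jump. A set $\mathcal M$ is forward invariant for $\mathcal H_\varepsilon$ if every maximal solution $\phi$ with $\phi(0,0)\in\mathcal M$ satisfies $\phi(t,j)\in\mathcal M$ for all $(t,j)\in\mathrm{dom}\,\phi$. *)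

(* Defs.v *)
From HB Require Import structures.
From mathcomp Require Import all_boot all_order all_algebra.
From mathcomp Require Import all_classical all_reals all_analysis.
Set Implicit Arguments.
Unset Strict Implicit.
Unset Printing Implicit Defensive.
Import Order.TTheory GRing.Theory Num.Theory.
Import numFieldNormedType.Exports.
Local Open Scope classical_set_scope.
Local Open Scope ring_scope.

(** * Hybrid systems in the sense of Goebel, Sanfelice and Teel *)

Record hybrid_system (V : Type) := HybridSystem {
  flow_set : set V;
  flow_map : V -> V;
  jump_set : set V;
  jump_map : V -> V (* only its values on [jump_set] matter *)
}.

Section Hybrid.
Context {R : realType}.

Definition hybrid_time_domain (E : set (R * nat)) : Prop :=
  E `<=` [set tj | 0 <= tj.1] /\
  forall (T : R) (J : nat), E (T, J) ->
    exists t : nat -> R,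
      [/\ t 0%N = 0,
          forall j, (j <= J)%N -> t j <= t j.+1 &
          E `&` [set tj | 0 <= tj.1 <= T /\ (tj.2 <= J)%N] =
          [set tj | (tj.2 <= J)%N /\ t tj.2 <= tj.1 <= t tj.2.+1] ].

Definition time_slice (E : set (R * nat)) (j : nat) : set R :=
  [set t | E (t, j)].

Section NormedSpace.
Context {V : normedModType R}.

Definition abs_continuous (f : R -> V) (a b : R) : Prop :=
  forall e : R, 0 < e -> exists2 delta : R, 0 < delta &
    forall (n : nat) (u v : nat -> R),
      (forall k, (k < n)%N -> [/\ a <= u k, u k <= v k & v k <= b]) ->
      (forall k l, (k < n)%N -> (l < n)%N -> k <> l ->
         v k <= u l \/ v l <= u k) ->
      \sum_(k < n) (v k - u k) < delta ->
      \sum_(k < n) `|f (v k) - f (u k)| < e.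

Definition locally_abs_continuous (f : R -> V) (I : set R) : Prop :=
  forall a b : R, a <= b -> `[a, b] `<=` I -> abs_continuous f a b.

(* A solution is a function on a hybrid time domain [E]; it is encoded by [E]
   together with a total function [phi] whose values outside [E] are
   irrelevant.  The derivative below is two-sided, which is harmless because
   the at most two endpoints of a time slice form a null set. *)
Definition solution (H : hybrid_system V) (E : set (R * nat))
    (phi : R -> nat -> V) : Prop :=
  [/\ hybrid_time_domain E,
      E (0, 0%N) /\ (flow_set H `|` jump_set H) (phi 0 0%N),
      forall j, locally_abs_continuous (phi ^~ j) (time_slice E j),
      forall j,
        (forall t, interior (time_slice E j) t -> flow_set H (phi t j)) /\
        {ae lebesgue_measure, forall t : R, time_slice E j t ->
           is_derive t 1 (phi ^~ j) (flow_map H (phi t j))} &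
      forall t j, E (t, j) -> E (t, j.+1) ->
        jump_set H (phi t j) /\ phi t j.+1 = jump_map H (phi t j)].

Definition maximal_solution (H : hybrid_system V) (E : set (R * nat))
    (phi : R -> nat -> V) : Prop :=
  solution H E phi /\
  forall (E' : set (R * nat)) (phi' : R -> nat -> V),
    solution H E' phi' -> E `<=` E' ->
    (forall t j, E (t, j) -> phi' t j = phi t j) ->
    E' = E.

Definition forward_invariant (H : hybrid_system V) (M : set V) : Prop :=
  forall (E : set (R * nat)) (phi : R -> nat -> V),
    maximal_solution H E phi -> M (phi 0 0%N) ->
    forall t j, E (t, j) -> M (phi t j).

End NormedSpace.
End Hybrid.

(** * The system [H_eps] *)

(* The ambient vector space of x = (tau_i, tau_k, a_i, a_k, tau, m^i, m^k, p, q).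
   The discrete variables p and q are real numbers, so that the flow map
   (which gives them derivative 0) takes values in the same space; that they
   range over {0,...,5} and {0,1} is part of the definition of [X]. *)
Definition state (R : realType) : Type :=
  (R * R * R * R * R * 'rV[R]_6 * 'rV[R]_6 * R * R)%type.

(* The ambient vector space of x_eps = (eps, x). *)
Definition estate (R : realType) : Type := ('cV[R]_2 * state R)%type.

Section System.
Context {R : realType}.
Implicit Types (x : state R) (xe : estate R) (m : 'rV[R]_6).

Definition row6 (s : seq R) : 'rV[R]_6 := \row_(i < 6) s`_i.
Definition col2 (a b : R) : 'cV[R]_2 := \col_(i < 2) [:: a; b]`_i.

(* [ent m n] is m_n, numbered from 1 to 6. *)
Definition ent m (n : nat) : R := m ord0 (inord n.-1).

(* (v, m_1, ..., m_5) *)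
Definition push (v : R) m : 'rV[R]_6 :=
  row6 [:: v; ent m 1; ent m 2; ent m 3; ent m 4; ent m 5].

Definition P_set : set R := [set 0; 1; 2; 3; 4; 5].
Definition Q_set : set R := [set 0; 1].

Definition X (d : R) : set (state R) :=
  [set x | let: (tau_i, tau_k, a_i, a_k, tau, mi, mk, p, q) := x in
           [/\ 0 <= tau <= d, P_set p & Q_set q]].

Definition Xe (d : R) : set (estate R) := [set xe | X d xe.2].

Definition F x : state R :=
  let: (tau_i, tau_k, a_i, a_k, tau, mi, mk, p, q) := x in
  (a_i, a_k, 0, 0, -1, 0, 0, 0, 0).

Definition K_o (mi : 'rV[R]_6) : R :=
  2^-1 * (ent mi 4 - ent mi 5 - ent mi 2 + ent mi 3).

Definition K_a (mu : R) (mi : 'rV[R]_6) (tau_k : R) : R :=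
  mu * ((ent mi 1 - ent mi 5) - (tau_k - ent mi 4)).

Definition G1 (d : R) x : state R :=
  let: (tau_i, tau_k, a_i, a_k, tau, mi, mk, p, q) := x in
  (tau_i, tau_k, a_i, a_k, d, push tau_i mi, mk, p + 1, 1).

Definition G2 (c : R) x : state R :=
  let: (tau_i, tau_k, a_i, a_k, tau, mi, mk, p, q) := x in
  (tau_i, tau_k, a_i, a_k, c, mi, push tau_k mi, p + 1, 0).

Definition G3 (d : R) x : state R :=
  let: (tau_i, tau_k, a_i, a_k, tau, mi, mk, p, q) := x in
  (tau_i, tau_k, a_i, a_k, d, mi, push tau_k mk, p + 1, 1).

Definition G4 (c : R) x : state R :=
  let: (tau_i, tau_k, a_i, a_k, tau, mi, mk, p, q) := x in
  (tau_i, tau_k, a_i, a_k, c, push tau_i mk, mk, p + 1, 0).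

Definition G5 (d : R) x : state R :=
  let: (tau_i, tau_k, a_i, a_k, tau, mi, mk, p, q) := x in
  (tau_i, tau_k, a_i, a_k, d, push tau_i mi, mk, p + 1, 1).

Definition G6 (c mu : R) x : state R :=
  let: (tau_i, tau_k, a_i, a_k, tau, mi, mk, p, q) := x in
  (tau_i, tau_k - K_o mi, a_i, a_k + K_a mu mi tau_k, c,
   mi, push tau_k mi, 0, 0).

Definition A_f : 'M[R]_2 := delta_mx 0 1.

Definition Fe xe : estate R := (A_f *m xe.1, F xe.2).

Definition Ce1 (c d : R) : set (estate R) :=
  [set xe | Xe d xe /\
    let: (eps, (tau_i, tau_k, a_i, a_k, tau, mi, mk, p, q)) := xe in
    q = 0 /\ 0 <= tau <= c].

Definition Ce2 (d : R) : set (estate R) :=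
  [set xe | Xe d xe /\
    let: (eps, (tau_i, tau_k, a_i, a_k, tau, mi, mk, p, q)) := xe in
    q = 1 /\ 0 <= tau <= d].

Definition Ce (c d : R) : set (estate R) := Ce1 c d `|` Ce2 d.

Definition De_ (d : R) (l : nat) : set (estate R) :=
  [set xe | Xe d xe /\
    let: (eps, (tau_i, tau_k, a_i, a_k, tau, mi, mk, p, q)) := xe in
    tau = 0 /\ p = l%:R - 1].

Definition De (d : R) : set (estate R) :=
  \bigcup_(l in [set l | (1 <= l <= 6)%N]) De_ d l.

Definition Ge6 (c mu : R) xe : estate R :=
  let: (eps, (tau_i, tau_k, a_i, a_k, tau, mi, mk, p, q)) := xe in
  (eps + col2 (K_o mi) (- K_a mu mi tau_k), G6 c mu xe.2).

(* The sets [De_ d l] are pairwise disjoint, so the order of the tests is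
   immaterial; the last value is never used. *)
Definition Ge (c d mu : R) xe : estate R :=
  if xe \in De_ d 1 then (xe.1, G1 d xe.2)
  else if xe \in De_ d 2 then (xe.1, G2 c xe.2)
  else if xe \in De_ d 3 then (xe.1, G3 d xe.2)
  else if xe \in De_ d 4 then (xe.1, G4 c xe.2)
  else if xe \in De_ d 5 then (xe.1, G5 d xe.2)
  else if xe \in De_ d 6 then Ge6 c mu xe
  else xe.

Definition He (c d mu : R) : hybrid_system (estate R) :=
  HybridSystem (Ce c d) Fe (De d) (Ge c d mu).

Definition rho_i (c d : R) xe (beta : R) : R :=
  let: (eps, (tau_i, tau_k, a_i, a_k, tau, mi, mk, p, q)) := xe in
  tau_i - a_i * ((1 - q) * c + q * d - tau) - a_i * beta.

Definition rho_k (c d : R) xe (beta : R) : R :=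
  let: (eps, (tau_i, tau_k, a_i, a_k, tau, mi, mk, p, q)) := xe in
  tau_k - a_k * ((1 - q) * c + q * d - tau) - a_k * beta.

Definition M1 (d : R) : set (estate R) :=
  [set xe | Xe d xe /\
    let: (eps, (tau_i, tau_k, a_i, a_k, tau, mi, mk, p, q)) := xe in
    p = 0 /\ q = 0].

Definition M2 (c d : R) : set (estate R) :=
  [set xe | Xe d xe /\
    let: (eps, (tau_i, tau_k, a_i, a_k, tau, mi, mk, p, q)) := xe in
    [/\ p = 1, q = 1 & ent mi 1 = rho_i c d xe 0]].

Definition M3 (c d : R) : set (estate R) :=
  [set xe | Xe d xe /\
    let: (eps, (tau_i, tau_k, a_i, a_k, tau, mi, mk, p, q)) := xe in
    [/\ p = 2, q = 0,
        ent mk 1 = rho_k c d xe 0 &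
        ent mk 2 = rho_i c d xe d]].

Definition M4 (c d : R) : set (estate R) :=
  [set xe | Xe d xe /\
    let: (eps, (tau_i, tau_k, a_i, a_k, tau, mi, mk, p, q)) := xe in
    [/\ p = 3, q = 1,
        ent mk 1 = rho_k c d xe 0,
        ent mk 2 = rho_k c d xe c &
        ent mk 3 = rho_i c d xe (c + d)]].

Definition M5 (c d : R) : set (estate R) :=
  [set xe | Xe d xe /\
    let: (eps, (tau_i, tau_k, a_i, a_k, tau, mi, mk, p, q)) := xe in
    (p = 4 /\ q = 0) /\
    [/\ ent mi 1 = rho_i c d xe 0,
        ent mi 2 = rho_k c d xe d,
        ent mi 3 = rho_k c d xe (c + d) &
        ent mi 4 = rho_i c d xe (2 * d + c)]].

Definition M6 (c d : R) : set (estate R) :=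
  [set xe | Xe d xe /\
    let: (eps, (tau_i, tau_k, a_i, a_k, tau, mi, mk, p, q)) := xe in
    (p = 5 /\ q = 1) /\
    [/\ ent mi 1 = rho_i c d xe 0,
        ent mi 2 = rho_i c d xe c,
        ent mi 3 = rho_k c d xe (c + d),
        ent mi 4 = rho_k c d xe (2 * c + d) &
        ent mi 5 = rho_i c d xe (2 * c + 2 * d)]].

Definition M (c d : R) : set (estate R) :=
  M1 d `|` M2 c d `|` M3 c d `|` M4 c d `|` M5 c d `|` M6 c d.

End System.

(* Main.v *)
Require Import Defs.
From mathcomp Require Import all_boot all_order all_algebra.
From mathcomp Require Import all_classical all_reals all_analysis.
From mathcomp Require Import ring lra.
Set Implicit Arguments.
Unset Strict Implicit.
Unset Printing Implicit Defensive.
Import Order.TTheory GRing.Theory Num.Theory.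
Import numFieldNormedType.Exports.
Local Open Scope ring_scope.

(** The clock values stored in [m^i] and [m^k] are time stamps.  While the
    system flows, [a_i] and [a_k] are constant, [tau_i] and [tau_k] grow with
    these slopes and the timer [tau] decreases with slope [-1].  The time since
    the last jump is [(1 - q) * c + q * d - tau], so [rho_i xe beta] is the
    value that [tau_i] had [beta] time units before the last jump, and this
    past value does not change along the flow ([drift_M]).  At a jump the timer
    has run down to 0, hence exactly [c] or [d] time units have passed since
    the previous jump; the jump map pushes the current clock value, all delays
    [beta] increase by this amount, and the conditions defining one piece of
    [M] become those of the next ([jump_M]).  The sixth jump leads back to
    [M1], where no stamp has been compared yet.

    The analytic content is that a solution, which is only absolutely
    continuous and satisfies the differential equation almost everywhere, does
    follow these straight lines.  [flow_drift] integrates the components one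
    after the other, since the flow map is a nilpotent linear map plus a
    constant: first the components of derivative zero, then [tau], [tau_i] and
    [tau_k], whose derivatives are by then known to be constant.  Each step is
    an instance of [ac_curve_affine]: an absolutely continuous curve with
    constant derivative almost everywhere is affine.  Its proof avoids the
    Vitali covering theorem by a continuity induction ([local_to_global]).

    Membership in [M] also requires [0 <= tau <= d].  In the interior of a time
    interval this comes from the flow set; the upper bound persists because
    [tau] decreases, and the lower bound passes to the right endpoint because
    an affine function that is negative there is negative just before.  The
    theorem follows by induction on the number of jumps. *)

(** * Absolutely continuous curves with prescribed derivative *)

(** Cousin's principle: a property of intervals that is transitive under
    concatenation and holds for all small intervals around each point holds
    globally.  It replaces the choice of a tagged partition; the proof looks at
    the supremum of the points reachable from [a]. *)
Lemma local_to_global (R : realType) (P : R -> R -> Prop) (a b : R) :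
  a <= b ->
  (forall r s t, P r s -> P s t -> P r t) ->
  (forall x, a <= x <= b -> exists2 delta, 0 < delta &
     forall s t, a <= s -> s <= x -> x <= t -> t <= b ->
       x - delta < s -> t < x + delta -> P s t) ->
  P a b.
Proof.
move=> ab Ptrans Ploc.
pose S : set R := [set x | a <= x <= b /\ P a x]%classic.
have aS : S a.
  split; first by rewrite lexx.
  have [|delta delta_gt0] := Ploc a; first by rewrite lexx.
  by apply; rewrite ?lexx // ?ltrBlDr ltrDl.
have bS : ubound S b by move=> x [/andP[]].
have supS : has_sup S by split; [exists a | exists b].
have am : a <= sup S by exact: (sup_upper_bound supS).
have mb : sup S <= b by apply: ge_sup => //; exists a.
have [|delta delta_gt0 Pm] := Ploc (sup S); first by rewrite am.
have [x Sx xm] := sup_adherent delta_gt0 supS.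
have [/andP[ax xb] Pax] := Sx.
have xsup : x <= sup S by exact: (sup_upper_bound supS).
pose t := Num.min b (sup S + delta / 2).
have mt : sup S <= t by rewrite le_min mb /=; lra.
have tb : t <= b by rewrite ge_min lexx.
have Pat : P a t.
  apply: (Ptrans _ x) => //; apply: Pm => //.
  by rewrite gt_min; apply/orP; right; lra.
have tm : t <= sup S by apply: (sup_upper_bound supS); split; rewrite ?tb ?andbT //; lra.
have [bt|tb'] := leP b t; first by have <- : t = b by lra.
move: tb' tm; rewrite /t; case: (leP b (sup S + delta / 2)) => _; lra.
Qed.

(** The point [y = x] is included, which makes the estimate usable at either
    end of an interval having [x] as an endpoint. *)
Lemma is_derive_approx (R : realType) (V : normedModType R) (f : R -> V)
    (x : R) (A : V) :
  is_derive x 1 f A -> forall e : R, 0 < e -> exists2 delta, 0 < delta &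
    forall y, `|y - x| < delta ->
      `|f y - f x - (y - x) *: A| <= e * `|y - x|.
Proof.
move=> [fx fxA] e e0.
have : (h^-1 *: ((f \o shift x) (h *: 1) - f x) @[h --> 0^'] --> A)%classic.
  by rewrite -fxA; exact: fx.
move=> /cvgrPdist_le /(_ e e0).
rewrite /dnbhs /within /= => /nbhs_ballP[delta /= delta0 H].
exists delta => // y yx.
have [->|ynx] := eqVneq y x; first by rewrite !subrr scale0r !subrr !normr0 mulr0.
have h0 : y - x != 0 by rewrite subr_eq0.
have := H (y - x); rewrite /ball /= sub0r normrN => /(_ yx h0).
have -> : (y - x) *: (1 : R) + x = y by rewrite /GRing.scale /= mulr1 subrK.
set B := f y - f x => HB.
have -> : B - (y - x) *: A = - ((y - x) *: (A - (y - x)^-1 *: B)).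
  by rewrite scalerBr scalerA divff // scale1r opprB.
by rewrite normrN normrZ mulrC ler_wpM2r.
Qed.

Section Curve.
Context {R : realType}.

(** Carathéodory solutions of [f' = g] on [[a, b]], with the velocity [g] given
    as a function of time so that it can be projected along with [f]. *)
Definition ac_curve {V : normedModType R} (f g : R -> V) (a b : R) : Prop :=
  abs_continuous f a b /\
  {ae lebesgue_measure, forall t : R, a <= t <= b -> is_derive t 1 f (g t)}.

(** Let [N] be the null set where the derivative may fail to be [A], and let
    [e > 0].  Cover [N] by an open set [U] of measure less than the modulus
    [delta] of absolute continuity.  Near a point outside [N], [f] deviates
    from slope [A] by at most [e] times the length; a short interval around a
    point of [N] lies in [U].  Chopping [[a, b]] accordingly, the intervals of
    the second kind have total length at most the measure of [U], so [f] varies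
    by less than [e] over all of them together. *)
Lemma ac_curve_affine (V : normedModType R) (f g : R -> V) (A : V) (a b : R) :
  a <= b -> ac_curve f g a b -> (forall t, a <= t <= b -> g t = A) ->
  f b = f a + (b - a) *: A.
Proof.
move=> ab [fac [N [mN N0 fN]]] gA.
pose mu : {measure set (measurableTypeR R) -> \bar R} := lebesgue_measure.
have {}N0 : mu N = 0%E by [].
suff H : forall e : R, 0 < e ->
    `|f b - f a - (b - a) *: A| <= e * (1 + `|A| + (b - a)).
  apply/eqP; rewrite -subr_eq0 opprD addrA -normr_eq0 -[_ == _]negbK.
  rewrite -normr_gt0 normr_id; apply/negP => D0.
  set D := `|_| in D0 H.
  have A0 := normr_ge0 A.
  have K0 : 0 < 1 + `|A| + (b - a) by lra.
  have e0 : 0 < D / (2 * (1 + `|A| + (b - a))) by rewrite divr_gt0 // mulr_gt0.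
  have := H _ e0.
  have -> : D / (2 * (1 + `|A| + (b - a))) * (1 + `|A| + (b - a)) = D / 2.
    by field; rewrite gt_eqF.
  lra.
move=> e e0; have [delta0 delta0_gt0 fdelta] := fac e e0.
(* The bound [e] on the total length controls the contribution
   [(v - u) *: A] of the exceptional intervals. *)
pose delta := Num.min delta0 e.
have delta_gt0 : 0 < delta by rewrite lt_min delta0_gt0.
have Nfin : (mu N < +oo)%E by rewrite N0 ltry.
have [U [oU NU UN]] := lebesgue_regularity_outer mN Nfin delta_gt0.
have mU : measurable (U : set (measurableTypeR R)).
  exact: measurable_realfun.open_measurable.
have Udelta : (mu U < delta%:E)%E.
  have UN0 : mu (U `&` N)%classic = 0%E.
    apply/eqP; rewrite eq_le measure_ge0 andbT -N0.
    by apply: le_measure; rewrite ?inE //; exact: measurableI.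
  have -> : mu U = (mu (U `\` N)%classic + mu (U `&` N)%classic)%E.
    exact: measureDI.
  by rewrite UN0 adde0.
have mUI s t : measurable (U `&` `]s, t] : set (measurableTypeR R))%classic.
  by apply: measurableI => //; exact: measurable_itv.
(* [P s t] keeps only the exceptional intervals of the chopping of [[s, t]];
   half-open intervals make the measures of the traces of [U] additive. *)
pose P s t := s <= t /\ exists n (u v : nat -> R), [/\
  forall k, (k < n)%N -> [/\ s <= u k, u k <= v k & v k <= t],
  forall k l, (k < n)%N -> (l < n)%N -> k <> l -> v k <= u l \/ v l <= u k,
  ((\sum_(k < n) (v k - u k))%:E <=
     mu (U `&` `]s, t])%classic)%E &
  `|f t - f s - (t - s) *: A| <= \sum_(k < n) `|f (v k) - f (u k)|
     + (\sum_(k < n) (v k - u k)) * `|A| + e * (t - s)].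
have [r s t|x xab|_ [n [u [v [uv disj len fab]]]]] :=
    @local_to_global R P a b ab; last 1 first.
- have lt_delta : \sum_(k < n) (v k - u k) < delta.
    rewrite -lte_fin; apply: le_lt_trans len _; apply: le_lt_trans Udelta.
    by apply: le_measure; rewrite ?inE.
  move: lt_delta; rewrite lt_min => /andP[lt_delta0 lt_e].
  apply: le_trans fab _; rewrite !mulrDr mulr1 lerD2r lerD //.
    exact/ltW/fdelta.
  by rewrite ler_wpM2r // ltW.
- move=> [rs [n1 [u1 [v1 [uv1 disj1 len1 f1]]]]].
  move=> [st [n2 [u2 [v2 [uv2 disj2 len2 f2]]]]].
  split; first exact: le_trans st.
  pose cat (w1 w2 : nat -> R) k := if (k < n1)%N then w1 k else w2 (k - n1)%N.
  have sum_cat (h : R -> R -> R) :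
      \sum_(k < n1 + n2) h (cat v1 v2 k) (cat u1 u2 k) =
      \sum_(k < n1) h (v1 k) (u1 k) + \sum_(k < n2) h (v2 k) (u2 k).
    rewrite big_split_ord /=; congr +%R; apply: eq_bigr => k _.
      by rewrite /cat ltn_ord.
    by rewrite /cat ltnNge leq_addr /= addKn.
  exists (n1 + n2)%N, (cat u1 u2), (cat v1 v2).
  have n2P k : (n1 <= k)%N -> (k < n1 + n2)%N -> (k - n1 < n2)%N.
    by move=> n1k; rewrite ltn_subLR.
  split.
  + move=> k kn; rewrite /cat; case: ltnP => kn1.
      by have [? ? ?] := uv1 _ kn1; split=> //; lra.
    by have [? ? ?] := uv2 _ (n2P _ kn1 kn); split=> //; lra.
  + move=> k l kn ln kl; rewrite /cat; case: ltnP => kn1; case: ltnP => ln1.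
    * exact: disj1.
    * have [_ _ ?] := uv1 _ kn1; have [? _ _] := uv2 _ (n2P _ ln1 ln).
      by left; lra.
    * have [_ _ ?] := uv1 _ ln1; have [? _ _] := uv2 _ (n2P _ kn1 kn).
      by right; lra.
    * apply: disj2; [exact: n2P..|] => /eqP; rewrite -(eqn_add2r n1) !subnK //.
      by move/eqP.
  + rewrite (sum_cat (fun y z => y - z)) EFinD; apply: le_trans (leeD len1 len2) _.
    rewrite -measureU; first last.
    * rewrite -subset0 => y /= [[_]]; rewrite in_itv /= => /andP[_ ?].
      by move=> [_]; rewrite in_itv /= => /andP[? _]; lra.
    * exact: mUI.
    * exact: mUI.
    apply: le_measure; rewrite ?inE; [exact: measurableU|exact: mUI|].
    move=> y [] [Uy /=]; rewrite in_itv /= => /andP[? ?]; split => //=;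
      by rewrite in_itv /=; lra.
  + rewrite (sum_cat (fun y z => y - z)) (sum_cat (fun y z => `|f y - f z|)).
    have -> : f t - f r - (t - r) *: A =
        (f s - f r - (s - r) *: A) + (f t - f s - (t - s) *: A).
      rewrite addrACA -opprD -scalerDl [f s - _ + _]addrC addrA subrK.
      by congr (_ - _ *: _); ring.
    apply: le_trans (ler_normD _ _) _.
    by rewrite mulrDl; lra.
have [Nx|Nx] := EM (N x).
- have [delta1 /= delta1_gt0 sub] := open_subball oU (NU _ Nx).
  exists (delta1 / 2); first lra.
  move=> s t aS sx xt tb xs tx; split; first lra.
  exists 1%N, (fun=> s), (fun=> t); split.
  + by move=> _ _; split=> //; lra.
  + by case=> // -[].
  + rewrite big_ord1.
    have -> : (U `&` `]s, t] = `]s, t])%classic.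
      apply/setIidPr => y /=; rewrite in_itv /= => /andP[sy yt].
      apply: (sub (delta1 / 2)) => /=.
      * by rewrite sub0r normrN gtr0_norm; lra.
      * lra.
      * by rewrite /ball /= distrC ltr_norml; lra.
    have -> : mu `]s, t]%classic = if (s%:E < t%:E)%E then (t%:E - s%:E)%E else 0%E.
      exact: (lebesgue_measure_itv `]s, t]).
    by rewrite lte_fin; case: ltP => // ts; rewrite lee_fin; lra.
  + rewrite !big_ord1; apply: le_trans (ler_normB _ _) _.
    rewrite normrZ ger0_norm; last lra.
    by rewrite lerDl mulr_ge0; lra.
- have dfx : is_derive x 1 f A.
    rewrite -(gA x xab); apply: contrapT => ndf; apply: Nx; apply: fN => /= H.
    exact/ndf/H.
  have [delta1 delta1_gt0 approx] := is_derive_approx dfx e0.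
  exists delta1 => // s t aS sx xt tb xs tx; split; first lra.
  exists 0%N, (fun=> s), (fun=> t); split => //.
  + by rewrite big_ord0 measure_ge0.
  + rewrite !big_ord0 mul0r !add0r.
    have H1 : `|f t - f x - (t - x) *: A| <= e * (t - x).
      have := approx t; rewrite ger0_norm; last lra.
      by apply; lra.
    have H2 : `|f s - f x - (s - x) *: A| <= e * (x - s).
      have := approx s; rewrite ler0_norm; last lra.
      by rewrite opprB; apply; lra.
    have -> : f t - f s - (t - s) *: A =
        (f t - f x - (t - x) *: A) - (f s - f x - (s - x) *: A).
      have -> : t - s = (t - x) - (s - x) by ring.
      rewrite scalerBl; symmetry.
      by rewrite opprD addrACA -opprD [- (f s - f x)]opprB addrA subrK.
    apply: le_trans (ler_normB _ _) _; lra.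
Qed.

End Curve.

(** * Restriction and projection of curves *)

Section Projections.
Context {R : realType}.

Lemma ae_lebesgueS (P Q : R -> Prop) :
  (forall t, P t -> Q t) ->
  {ae lebesgue_measure, forall t : R, P t} ->
  {ae lebesgue_measure, forall t : R, Q t}.
Proof.
by move=> PQ; apply: filterS PQ; exact: (ae_filter_ringOfSetsType lebesgue_measure).
Qed.

Lemma ac_curve_sub (V : normedModType R) (f g : R -> V) (a b a' b' : R) :
  a <= a' -> b' <= b -> ac_curve f g a b -> ac_curve f g a' b'.
Proof.
move=> aa' bb' [fac fg]; split.
- move=> e e0; have [delta delta0 fd] := fac e e0.
  exists delta => // n u v uv; apply: fd => k kn.
  by have [? ? ?] := uv k kn; split=> //; lra.
- by apply: ae_lebesgueS fg => t + abt; apply; lra.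
Qed.

Lemma is_derive_fst (V W : normedModType R) (f : R -> V * W) (t : R) A :
  is_derive t 1 f A -> is_derive t 1 (fst \o f) A.1.
Proof.
move=> [df dA].
have : (h^-1 *: ((f \o shift t) (h *: 1) - f t) @[h --> 0^'] --> (A.1, A.2))%classic.
  by rewrite -surjective_pairing -dA; exact: df.
move=> /cvg_comp /(_ cvg_fst) H.
by split; [exact: cvgP H | exact: cvg_lim H].
Qed.

Lemma is_derive_snd (V W : normedModType R) (f : R -> V * W) (t : R) A :
  is_derive t 1 f A -> is_derive t 1 (snd \o f) A.2.
Proof.
move=> [df dA].
have : (h^-1 *: ((f \o shift t) (h *: 1) - f t) @[h --> 0^'] --> (A.1, A.2))%classic.
  by rewrite -surjective_pairing -dA; exact: df.
move=> /cvg_comp /(_ cvg_snd) H.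
by split; [exact: cvgP H | exact: cvg_lim H].
Qed.

(** Applied to projections, which do not increase the max norm of a product. *)
Lemma abs_continuous_dominated (V W : normedModType R) (f : R -> V)
    (h : R -> W) (a b : R) :
  (forall s t, `|h s - h t| <= `|f s - f t|) ->
  abs_continuous f a b -> abs_continuous h a b.
Proof.
move=> hf fac e e0; have [delta delta0 fd] := fac e e0.
exists delta => // n u v uv disj len; apply: le_lt_trans (fd n u v uv disj len).
exact: ler_sum.
Qed.

Lemma ac_curve_fst (V W : normedModType R) (f g : R -> V * W) (a b : R) :
  ac_curve f g a b -> ac_curve (fst \o f) (fst \o g) a b.
Proof.
move=> [fac fg]; split.
  by apply: abs_continuous_dominated fac => s t; rewrite prod_normE le_max lexx.
by apply: ae_lebesgueS fg => t + abt => /(_ abt); exact: is_derive_fst.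
Qed.

Lemma ac_curve_snd (V W : normedModType R) (f g : R -> V * W) (a b : R) :
  ac_curve f g a b -> ac_curve (snd \o f) (snd \o g) a b.
Proof.
move=> [fac fg]; split.
  by apply: abs_continuous_dominated fac => s t; rewrite prod_normE le_max lexx orbT.
by apply: ae_lebesgueS fg => t + abt => /(_ abt); exact: is_derive_snd.
Qed.

End Projections.

(** * Flows *)

Section Flow.
Context {R : realType}.
Implicit Types (x : state R) (xe : estate R).

(** The exact flow of [F] for a duration [h], in closed form. *)
Definition drift (h : R) x : state R :=
  let: (tau_i, tau_k, a_i, a_k, tau, mi, mk, p, q) := x in
  (tau_i + h * a_i, tau_k + h * a_k, a_i, a_k, tau - h, mi, mk, p, q).

(** The order of integration matters: [tau_i] and [tau_k] have constant
    derivatives only once [a_i] and [a_k] are known to be constant. *)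
Lemma flow_drift (f : R -> estate R) (a b : R) :
  a <= b -> ac_curve f (Fe \o f) a b ->
  exists eps, f b = (eps, drift (b - a) (f a).2).
Proof.
move=> ab /ac_curve_snd C0.
have C1 := ac_curve_fst C0; have C2 := ac_curve_fst C1.
have C3 := ac_curve_fst C2; have C4 := ac_curve_fst C3.
have C5 := ac_curve_fst C4; have C6 := ac_curve_fst C5.
have C7 := ac_curve_fst C6; have C8 := ac_curve_fst C7.
have const (V : normedModType R) (h g : R -> V) :
    ac_curve h g a b -> (forall t, g t = 0) ->
    forall t, a <= t <= b -> h t = h a.
  move=> hg g0 t /andP[at_ tb].
  have hg' := ac_curve_sub (lexx a) tb hg.
  by rewrite (ac_curve_affine at_ hg' (fun s _ => g0 s)) scaler0 addr0.
have bab : a <= b <= b by rewrite ab lexx.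
have FE t : F (f t).2 =
    ((f t).2.1.1.1.1.1.1.2, (f t).2.1.1.1.1.1.2, 0, 0, -1, 0, 0, 0, 0).
  by case: (f t).2 => [[[[[[[[]]]]]]]].
have Eq : (f b).2.2 = (f a).2.2.
  by apply: (const _ _ _ (ac_curve_snd C0)) bab => t /=; rewrite FE.
have Ep : (f b).2.1.2 = (f a).2.1.2.
  by apply: (const _ _ _ (ac_curve_snd C1)) bab => t /=; rewrite FE.
have Emk : (f b).2.1.1.2 = (f a).2.1.1.2.
  by apply: (const _ _ _ (ac_curve_snd C2)) bab => t /=; rewrite FE.
have Emi : (f b).2.1.1.1.2 = (f a).2.1.1.1.2.
  by apply: (const _ _ _ (ac_curve_snd C3)) bab => t /=; rewrite FE.
have Eak t : a <= t <= b -> (f t).2.1.1.1.1.1.2 = (f a).2.1.1.1.1.1.2.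
  by apply: (const _ _ _ (ac_curve_snd C5)) => s /=; rewrite FE.
have Eai t : a <= t <= b -> (f t).2.1.1.1.1.1.1.2 = (f a).2.1.1.1.1.1.1.2.
  by apply: (const _ _ _ (ac_curve_snd C6)) => s /=; rewrite FE.
have Etau : (f b).2.1.1.1.1.2 = (f a).2.1.1.1.1.2 + (b - a) * -1.
  by apply: (ac_curve_affine ab (ac_curve_snd C4)) => t _ /=; rewrite FE.
have Etk : (f b).2.1.1.1.1.1.1.1.2 =
    (f a).2.1.1.1.1.1.1.1.2 + (b - a) * (f a).2.1.1.1.1.1.2.
  by apply: (ac_curve_affine ab (ac_curve_snd C7)) => t /Eak <- /=; rewrite FE.
have Eti : (f b).2.1.1.1.1.1.1.1.1 =
    (f a).2.1.1.1.1.1.1.1.1 + (b - a) * (f a).2.1.1.1.1.1.1.2.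
  by apply: (ac_curve_affine ab C8) => t /Eai <- /=; rewrite FE.
rewrite mulrN1 in Etau.
have {}Eak := Eak b bab; have {}Eai := Eai b bab.
exists (f b).1; rewrite [LHS]surjective_pairing; congr pair.
move: Etau Eq Ep Emk Emi Eak Eai Etk Eti.
case: (f b).2 => [[[[[[[[? ?] ?] ?] ?] ?] ?] ?] ?].
case: (f a).2 => [[[[[[[[? ?] ?] ?] ?] ?] ?] ?] ?] /=.
by do 9!move=> ->.
Qed.

(** During a flow of duration [h] the clock gains [h * a] while the time since
    the last jump grows by [h], so [rho_i] and [rho_k] are unchanged.  Only the
    lower bound on the timer can fail, hence the second hypothesis. *)
Lemma drift_M (c d h : R) xe eps :
  0 <= h -> 0 <= xe.2.1.1.1.1.2 - h -> M c d xe -> M c d (eps, drift h xe.2).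
Proof.
case: xe => eps0 [[[[[[[[ti tk] ai] ak] tau] mi] mk] p] q] /= h0 tauh.
have XD : 0 <= tau <= d -> 0 <= tau - h <= d by move=> ?; lra.
have E (z alpha r beta : R) :
    z + h * alpha - alpha * (r - (tau - h)) - alpha * beta =
    z - alpha * (r - tau) - alpha * beta by ring.
case=> [[[[[]|]|]|]|] [[/XD tau' P0 Q0]] H.
- by do 5!left.
- by do 4!left; right; split=> //; move: H; rewrite /= !E.
- by do 3!left; right; split=> //; move: H; rewrite /= !E.
- by do 2!left; right; split=> //; move: H; rewrite /= !E.
- by left; right; split=> //; move: H; rewrite /= !E.
- by right; split=> //; move: H; rewrite /= !E.
Qed.

Lemma M_tau (c d : R) xe : M c d xe -> 0 <= xe.2.1.1.1.1.2 <= d.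
Proof.
case: xe => eps0 [[[[[[[[ti tk] ai] ak] tau] mi] mk] p] q].
by case=> [[[[[]|]|]|]|] [[]].
Qed.

Lemma Ce_tau (c d : R) xe : Ce c d xe -> 0 <= xe.2.1.1.1.1.2.
Proof.
case: xe => eps0 [[[[[[[[ti tk] ai] ak] tau] mi] mk] p] q].
by case=> -[_ [_ /andP[]]].
Qed.

(** The flow set constrains only interior times of [E]; the timer at the right
    endpoint is bounded below by looking at a slightly earlier time. *)
Lemma flow_M (c d mu : R) E phi (j : nat) (s t : R) :
  solution (He c d mu) E phi -> s <= t ->
  (forall r, s <= r <= t -> E (r, j)) ->
  M c d (phi s j) -> M c d (phi t j).
Proof.
move=> [_ _ acphi flow _] st Est Ms.
have [intC ae_phi] := flow j.
have C : ac_curve (phi ^~ j) (Fe \o phi ^~ j) s t.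
  split.
    by apply: acphi => // r /=; rewrite in_itv /=; exact: Est.
  by apply: ae_lebesgueS ae_phi => r + srt; apply; exact: Est.
have [eps phit] := flow_drift st C.
rewrite phit; apply: drift_M => //; first lra.
have tau_s := M_tau Ms.
set tau := _.2 in tau_s *.
rewrite leNgt; apply/negP => tau_t.
(* If the timer, of slope [-1], is negative at [t], then it vanished at
   [t + (tau - (t - s))]; halfway from there to [t] it is negative as well. *)
pose r := t + (tau - (t - s)) / 2.
have sr : s < r by rewrite /r; lra.
have rt : r < t by rewrite /r; lra.
have intr : interior (time_slice E j) r.
  have rst : r \in `]s, t[ by rewrite in_itv /= sr.
  apply: filterS (near_in_itvoo rst) => u; rewrite in_itv /= => /andP[su ut].
  by apply: Est; rewrite !ltW.
have [eps' phir] := flow_drift (ltW sr) (ac_curve_sub (lexx s) (ltW rt) C).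
have := Ce_tau (intC r intr).
rewrite phir /=; move: @tau tau_s tau_t @r sr rt {intr phir}.
case: (phi s j).2 => [[[[[[[[? ?] ?] ?] ?] ?] ?] ?] ?] /=; lra.
Qed.

End Flow.

(** * Jumps *)

Section Jump.
Context {R : realType}.
Implicit Types (xe : estate R) (m : 'rV[R]_6).

Lemma ent_push1 v m : ent (push v m) 1 = v.
Proof. by rewrite /ent /push mxE inordK. Qed.

Lemma ent_pushS v m k : (0 < k < 6)%N -> ent (push v m) k.+1 = ent m k.
Proof.
case/andP=> k0 k6; rewrite {1}/ent /push mxE inordK //=.
by case: k k0 k6 => [|[|[|[|[|[|]]]]]].
Qed.

(** The value of [p] determines the index, so this evaluates the cascade of
    tests in [Ge]. *)
Lemma mem_De_ (d : R) l l' xe : De_ d l xe -> (xe \in De_ d l') = (l' == l).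
Proof.
move=> D; apply/idP/eqP => [|->]; last by rewrite inE.
rewrite inE; move: D.
case: xe => eps [[[[[[[[ti tk] ai] ak] tau] mi] mk] p] q].
by move=> [_ [_ ->]] [_ [_ /addIr/eqP]]; rewrite eqr_nat => /eqP.
Qed.

Lemma De_tau0 (d : R) xe : De d xe -> xe.2.1.1.1.1.2 = 0.
Proof.
case: xe => eps [[[[[[[[ti tk] ai] ak] tau] mi] mk] p] q].
by move=> [l _ [_ []]].
Qed.

(** The hypothesis [c <= d] is what allows a timer reset to [c] to stay in
    [[0, d]].  The conditions on the stored values follow by comparing, entry by
    entry, a push with the definitions of [rho_i] and [rho_k] at the old state,
    where [tau = 0], and at the new one, where the time since the last jump
    is 0. *)
Lemma jump_M (c d mu : R) xe :
  0 < c -> c <= d -> M c d xe -> De d xe -> M c d (Ge c d mu xe).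
Proof.
move=> c0 cd Mxe /De_tau0; move: Mxe.
case: xe => eps [[[[[[[[ti tk] ai] ak] tau] mi] mk] p] q] /= Mxe tau0.
rewrite {tau}tau0 in Mxe *.
have d0 : 0 <= d <= d by lra.
have c0d : 0 <= c <= d by lra.
have z0d : 0 <= (0 : R) <= d by lra.
set xe := (X in Ge _ _ _ X).
have De_p l : M c d xe -> p = l%:R - 1 -> De_ d l xe.
  by move=> Mx pl; split=> //; case: Mx => [[[[[]|]|]|]|] [].
have P k : (k < 6)%N -> P_set (k%:R : R).
  rewrite /P_set /=; case: k => [|[|[|[|[|[|]]]]]] //; tauto.
move: (Mxe) => [[[[[]|]|]|]|] [_].
- move=> [p0 q0].
  have D : De_ d 1 xe by apply: De_p => //; rewrite p0 subrr.
  rewrite /Ge !(mem_De_ _ D) /=; do 4!left; right; split.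
    by split=> //; [rewrite p0 add0r; exact: (P 1) | right].
  by split; rewrite /rho_i /rho_k ?p0 ?add0r ?ent_push1 //; ring.
- move=> [p0 q0 H1].
  have D : De_ d 2 xe by apply: De_p => //; rewrite p0; ring.
  rewrite /Ge !(mem_De_ _ D) /=; do 3!left; right; split.
    by split=> //; [rewrite p0 -[1 + 1]/(2%:R); exact: (P 2) | left].
  by split; rewrite ?p0 ?ent_push1 ?ent_pushS ?H1 /rho_i /rho_k ?q0 //; ring.
- move=> [p0 q0 H1 H2].
  have D : De_ d 3 xe by apply: De_p => //; rewrite p0; ring.
  rewrite /Ge !(mem_De_ _ D) /=; do 2!left; right; split.
    split=> //; [rewrite p0 (_ : 2 + 1 = 3%:R); [exact: (P 3)|ring] | by right].
  by split; rewrite ?p0 ?ent_push1 ?ent_pushS ?H1 ?H2 /rho_i /rho_k ?q0 //; ring.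
- move=> [p0 q0 H1 H2 H3].
  have D : De_ d 4 xe by apply: De_p => //; rewrite p0; ring.
  rewrite /Ge !(mem_De_ _ D) /=; left; right; split.
    split=> //; [rewrite p0 (_ : 3 + 1 = 4%:R); [exact: (P 4)|ring] | by left].
  split; first by split; rewrite ?p0 //; ring.
  by split; rewrite ?ent_push1 ?ent_pushS ?H1 ?H2 ?H3 /rho_i /rho_k ?q0 //; ring.
- move=> [[p0 q0] [H1 H2 H3 H4]].
  have D : De_ d 5 xe by apply: De_p => //; rewrite p0; ring.
  rewrite /Ge !(mem_De_ _ D) /=; right; split.
    split=> //; [rewrite p0 (_ : 4 + 1 = 5%:R); [exact: (P 5)|ring] | by right].
  split; first by split; rewrite ?p0 //; ring.
  by split; rewrite ?ent_push1 ?ent_pushS ?H1 ?H2 ?H3 ?H4 /rho_i /rho_k ?q0 //; ring.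
- move=> [[p0 q0] _].
  have D : De_ d 6 xe by apply: De_p => //; rewrite p0; ring.
  rewrite /Ge !(mem_De_ _ D) /=; do 5!left; split.
    by split=> //; [exact: (P 0) | left].
  by split.
Qed.

End Jump.

(** * Forward invariance *)

Theorem lemma4p3 (R : realType) (c d mu : R)
  (c_gt0 : 0 < c) (c_le_d : c <= d) (mu_gt0 : 0 < mu) :
  forward_invariant (He c d mu) (M c d).
Proof.
move=> E phi [sol _] M0 T J ETJ.
have [[E_ge0 E_dom] _ _ _ jump] := sol.
have [t [t0 tle EJ]] := E_dom T J ETJ.
have slice j r : (j <= J)%N -> t j <= r <= t j.+1 -> E (r, j).
  move=> jJ rj; have : [set tj : R * nat | (tj.2 <= J)%N /\
      t tj.2 <= tj.1 <= t tj.2.+1]%classic (r, j) by [].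
  by rewrite -EJ => -[].
have TJ : t J <= T <= t J.+1.
  have : (E `&` [set tj | 0 <= tj.1 <= T /\ (tj.2 <= J)%N])%classic (T, J).
    by split=> //=; rewrite lexx leqnn andbT; split => //; exact: (E_ge0 _ ETJ).
  by rewrite EJ => -[].
have M_start j : (j <= J)%N -> M c d (phi (t j) j).
  elim: j => [|j IH] jJ; first by rewrite t0.
  have Mend : M c d (phi (t j.+1) j).
    apply: (flow_M sol (tle j (ltnW jJ))) (IH (ltnW jJ)) => r.
    exact: slice (ltnW jJ).
  have Ej : E (t j.+1, j) by apply: slice; rewrite ?lexx ?tle // ltnW.
  have EjS : E (t j.+1, j.+1) by apply: slice; rewrite ?lexx ?tle.
  by have [D ->] := jump _ _ Ej EjS; exact: jump_M.
have [tJT TtJ] := andP TJ.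
apply: (flow_M sol tJT) (M_start J (leqnn J)) => r /andP[tr rT].
by apply: slice => //; rewrite tr (le_trans rT).
Qed.
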